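(* Let $n\geq 1$, let $\mathcal{O}$ be a conjugacy class in $S_{n+1}$ and $C$ a conjugacy class in $SL(n+1,\mathbf{k})$. Then $\mathcal{O} \subset W_C$ if and only if $\lambda(\mathcal{O}) \leq \tilde{\nu}^*(C)$.
   Context: $\mathbf{k}$ is an algebraically closed field. $B$ is the subgroup of upper-triangular matrices in $SL(n+1,\mathbf{k})$ and $H$ the subgroup of diagonal matrices. The Weyl group $N_G(H)/H$ of $G = SL(n+1,\mathbf{k})$ is identified with the permutation group $S_{n+1}$ of $\{1,\dots,n+1\}$ (a representative $\dot w$ of $w$ is a monomial matrix whose nonzero entries are in positions $(w(i), i)$), and $BwB = B\dot{w}B$. For a conjugacy class $C$ in $SL(n+1,\mathbf{k})$, $W_C = \{w \in S_{n+1} : C\cap(BwB)\neq\emptyset\}$. A partition of $p$ is a non-increasing sequence of positive integers with sum $p$. For partitions $\lambda = (\lambda_1,\dots,\lambda_s)$ and $\mu = (\mu_1,\dots,\mu_t)$ of $p$, $\lambda\leq\mu$ means $\sum_{j=1}^k\lambda_j \leq \sum_{j=1}^k\mu_j$ for every $1\leq k\leq t$ (with $\lambda_j = 0$ for $j > s$). For a conjugacy class $\mathcal{O}$ in $S_{n+1}$, $\lambda(\mathcal{O})$ is the partition of $n+1$ formed by the lengths of the cycles (including those of length $1$) in the cycle decomposition of any $w \in\mathcal{O}$. For a conjugacy class $C$ in $SL(n+1,\mathbf{k})$, the partition $\tilde{\nu}^*(C)$ of $n+1$ is defined as follows: let $c_1,\dots,c_k$ be the distinct eigenvalues of (any element of)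 $C$, and for $1\leq j\leq k$ let $d_j>0$ and $n_{j,1}\geq\cdots\geq n_{j,d_j}>0$ be respectively the number and the sizes of the Jordan blocks with eigenvalue $c_j$, with the eigenvalues ordered so that $d_1\geq\cdots\geq d_k$. Then $\tilde{\nu}^*(C) = (\xi_1,\dots,\xi_{d_1})$, where $\xi_t = n_{1,t}+\cdots+n_{k,t}$ for $1\leq t\leq d_1$, with $n_{j,s} = 0$ for $d_j<s\leq d_1$. *)

(* Defs.v *)
From HB Require Import structures.
From mathcomp Require Import all_boot all_order all_algebra all_fingroup.
Set Implicit Arguments. Unset Strict Implicit. Unset Printing Implicit Defensive.
Import GRing.Theory.
Local Open Scope ring_scope.

(* Partitions are non-increasing sequences of positive naturals; the sum of the
   first m parts pads with zeros past the end of the sequence. *)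
Definition dominated (la mu : seq nat) : Prop :=
  forall m, (1 <= m <= size mu)%N ->
    (\sum_(j < m) nth 0 la j <= \sum_(j < m) nth 0 mu j)%N.

(* [porbits w] is the set of supports of the cycles of w, fixed points
   included. *)
Definition cycle_type (T : finType) (w : {perm T}) : seq nat :=
  sort geq [seq #|X| | X : {set T} <- enum (porbits w)].

Lemma cycle_typeJ (T : finType) (w g : {perm T}) :
  cycle_type (w ^ g)%g = cycle_type w.
Proof.
have oJ x : porbit (w ^ g)%g (g x) = g @: porbit w x.
  apply/setP=> y; apply/porbitP/imsetP.
    case=> i ->; exists ((w ^+ i)%g x); first by rewrite mem_porbit.
    by rewrite -conjXg conjgE !permM permK.
  case=> z /porbitP[i ->] ->; exists i.
  by rewrite -conjXg conjgE !permM permK.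
have gI : injective (fun X : {set T} => g @: X) by exact/imset_inj/perm_inj.
have E : porbits (w ^ g)%g = [set g @: (X : {set T}) | X in porbits w].
  apply/setP=> Y; apply/imsetP/imsetP.
    case=> y _ ->; exists (porbit w (g^-1%g y)); first exact: imset_f.
    by rewrite -oJ permKV.
  by case=> X /imsetP[x _ ->] ->; exists (g x); rewrite ?oJ.
apply/perm_sortP; first by move=> a b; exact: leq_total.
- by move=> b a c /= ba cb; exact: leq_trans cb ba.
- by move=> a b /andP[ab ba]; apply/eqP; rewrite eqn_leq; apply/andP.
have P : perm_eq (enum (porbits (w ^ g)%g))
                 [seq g @: (X : {set T}) | X <- enum (porbits w)].
  apply: uniq_perm; rewrite ?enum_uniq ?map_inj_uniq ?enum_uniq //.
  move=> Y; rewrite mem_enum E; apply/imsetP/mapP.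
    by case=> X XW ->; exists X; rewrite ?mem_enum.
  by case=> X; rewrite mem_enum => XW ->; exists X.
apply: perm_trans (perm_map _ P) _; rewrite -map_comp.
rewrite (@eq_map _ _ _ (fun X : {set T} => #|X|)) // => X /=.
by rewrite card_imset //; exact: perm_inj.
Qed.

(* [repr O] is an element of O when O is a class; the choice is immaterial by
   [cycle_typeJ]. *)
Definition lambda (n : nat) (O : {set 'S_n}) : seq nat := cycle_type (repr O).

Lemma lambdaE (n : nat) (O : {set 'S_n}) (w : 'S_n) :
  O \in classes [set: 'S_n] -> w \in O -> lambda O = cycle_type w.
Proof.
case/imsetP=> v _ ->{O} wO; rewrite /lambda.
have : repr (v ^: [set: 'S_n])%g \in (v ^: [set: 'S_n])%g by exact: mem_repr wO.
by case/imsetP: wO => g _ -> /imsetP[h _ ->]; rewrite !cycle_typeJ.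
Qed.

Section Matrices.
Variables (k : closedFieldType) (n : nat).

Definition SL_conj_class (C : 'M[k]_n -> Prop) : Prop :=
  exists2 A : 'M[k]_n, \det A = 1 &
    forall X, C X <-> exists2 g : 'M[k]_n, \det g = 1 & X = g *m A *m invmx g.

(* [is_trig_mx] means lower triangular. *)
Definition in_B (b : 'M[k]_n) : Prop := \det b = 1 /\ is_trig_mx b^T.

Definition weyl_rep (w : 'S_n) (dw : 'M[k]_n) : Prop :=
  \det dw = 1 /\ forall i j, (dw i j != 0) = (i == w j).

Definition in_BwB (w : 'S_n) (X : 'M[k]_n) : Prop :=
  exists b dw b' : 'M[k]_n,
    [/\ in_B b, weyl_rep w dw, in_B b' & X = b *m dw *m b'].

Definition W_ (C : 'M[k]_n -> Prop) (w : 'S_n) : Prop :=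
  exists2 X, C X & in_BwB w X.

End Matrices.

Section Jordan.
Variable k : closedFieldType.

Definition jordan_block (c : k) (m : nat) : 'M[k]_m :=
  \matrix_(i, j) (c *+ (i == j) + (i.+1 == j :> nat)%:R).

(* A list of pairs (eigenvalue, size) encodes the block-diagonal matrix with
   the corresponding Jordan blocks. *)
Definition jordan_mx (js : seq (k * nat)) :=
  \mxdiag_(i < size js)
    jordan_block (tnth (in_tuple js) i).1 (tnth (in_tuple js) i).2.

(* The dimensions of A and [jordan_mx js] are equal but not convertible;
   the two conditions on P say that it is square and invertible. *)
Definition jordan_form (n : nat) (A : 'M[k]_n) (js : seq (k * nat)) : Prop :=
  all (fun p => 0 < p.2)%N js /\
  exists P, [/\ row_free P, row_full P & P *m A = jordan_mx js *m P].

Definition eigs (js : seq (k * nat)) : seq k := undup [seq p.1 | p <- js].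

Definition block_sizes (js : seq (k * nat)) (c : k) : seq nat :=
  sort geq [seq p.2 | p <- js & p.1 == c].

(* With the eigenvalues ordered by non-increasing number of blocks, d_1 is the
   maximal number of blocks; the sums xi_t do not depend on the ordering.
   Indices t are shifted to start from 0. *)
Definition xi (js : seq (k * nat)) : seq nat :=
  mkseq (fun t => \sum_(c <- eigs js) nth 0 (block_sizes js c) t)%N
    (\max_(c <- eigs js) size (block_sizes js c)).

(* The Jordan form of an element of C exists and is unique up to the order of
   the blocks, so this relation determines nu from C. *)
Definition is_nu_star (n : nat) (C : 'M[k]_n -> Prop) (nu : seq nat) : Prop :=
  exists A js, [/\ C A, jordan_form A js & nu = xi js].

End Jordan.

(* Main.v *)
Require Import Defs.
From HB Require Import structures.
From mathcomp Require Import all_boot all_order all_algebra all_fingroup.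
From mathcomp Require Import zify.
Set Implicit Arguments. Unset Strict Implicit. Unset Printing Implicit Defensive.
Import GRing.Theory.
Local Open Scope ring_scope.

(** Let A be an element of the class C, acting on row vectors.  The partition
    nu attached to C lists the degrees of the invariant factors of A: merging,
    for each t, the t-th largest Jordan blocks of all eigenvalues gives
    generators z_t of the k[A]-module of row vectors, where z_t is killed by
    f_t, the degree of f_t is nu_t, and f_{t+1} divides f_t
    ([cyclic_chain_of_jordan]).  Everything is read off from this list.

    Necessity.  A conjugate w of a given permutation can be chosen whose cycles
    act on consecutive integers by i -> i+1, the longest cycles on the largest
    integers ([consecutive_conjugate]).  If X lies in BwB, then row i+1 of X
    expresses e_i through e_{i+1} X and the e_l with l > i, unless i is the end
    of a cycle.  So the span of the last la_1 + ... + la_m basis vectors lies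
    in the k[X]-submodule generated by m vectors ([hessenberg_generate]).  For
    any monic f, such a submodule is contained in the sum of the image of f(X)
    and of m spaces of dimension deg f ([krylov_closure]).  With f = f_{m+1},
    the rank of f(X) is at most the sum of deg f_t - deg f over t <= m
    ([cyclic_chain_rank]), and la_1 + ... + la_m <= nu_1 + ... + nu_m follows.

    Sufficiency.  If la is dominated by nu then, for every ordering of the
    parts of la, the module has a filtration whose successive quotients are
    cyclic of these dimensions ([krylov_tower_exists]).  One part a is peeled
    off at a time: choose t with nu_t >= a >= nu_{t+1}; the two generators z_t
    and z_{t+1} are replaced by q(A) z_t + z_{t+1}, which is killed by
    g = f_t / q, where f_{t+1} | g | f_t; the quotient is generated by z_t and
    has dimension a for the right degree of g ([cyclic_chain_peel]).  Order
    the cycles of w by their minima and number the filtration accordingly.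
    Placing the successive images of each generator along its cycle, so that
    only the last one, sent to an arbitrary vector of the filtration step, sits
    at the minimum, gives a basis in which A has the shape of an upper
    triangular matrix times a representative of w ([bruhat_of_tower]).  Since
    the ordering of the parts is free, this handles every w at once. *)

(** * Krylov spaces *)

Section Krylov.
Variables (k : fieldType) (n : nat) (A : 'M[k]_n.+1).
Implicit Types (v : 'rV[k]_n.+1) (W Z : 'M[k]_n.+1) (f g h : {poly k}).

Definition krylov v a : 'M[k]_(a, n.+1) := \matrix_(j < a) (v *m A ^+ j).

Lemma krylov_subP v a m (Z : 'M[k]_(m, n.+1)) :
  reflect (forall j, (j < a)%N -> (v *m A ^+ j <= Z)%MS) (krylov v a <= Z)%MS.
Proof.
apply: (iffP row_subP) => [sZ j ja | sZ j]; last by rewrite rowK sZ.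
by have := sZ (Ordinal ja); rewrite rowK.
Qed.

Lemma mul_horner_mx v f :
  v *m horner_mx A f = \sum_(j < size f) f`_j *: (v *m A ^+ j).
Proof.
have [->|f0] := eqVneq f 0; first by rewrite rmorph0 mulmx0 size_poly0 big_ord0.
rewrite /horner_mx /horner_morph horner_coef size_map_poly_id0; last first.
  by rewrite fmorph_eq0 lead_coef_eq0.
rewrite mulmx_sumr; apply: eq_bigr => j _.
by rewrite coef_map /= scalemxAr -mul_scalar_mx.
Qed.

Lemma horner_mx_sub Z v f :
  stablemx Z A -> (v <= Z)%MS -> (v *m horner_mx A f <= Z)%MS.
Proof.
by move=> sZ vZ; apply: submx_trans (submxMr _ vZ) (horner_mx_stable _ sZ).
Qed.

Lemma horner_mx_krylov v f a :
  (size f <= a)%N -> (v *m horner_mx A f <= krylov v a)%MS.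
Proof.
move=> fa; rewrite mul_horner_mx; apply: summx_sub => j _; apply: scalemx_sub.
by move/krylov_subP: (submx_refl (krylov v a)); apply; apply: leq_trans fa.
Qed.

(** A monic relation of degree [a] expresses the power [a] through the lower
    ones. *)
Lemma krylov_top Z v f a : f \is monic -> size f = a.+1 ->
  (v *m horner_mx A f <= Z)%MS -> (krylov v a <= Z)%MS -> (v *m A ^+ a <= Z)%MS.
Proof.
move=> fm fs vf vZ.
have E : 'X^a = f - (f - 'X^a) :> {poly k} by rewrite opprB addrC subrK.
rewrite -[in A ^+ a](horner_mx_X A) -rmorphXn E rmorphB mulmxBr.
apply: addmx_sub; first by [].
rewrite -mulmxN -rmorphN; apply: submx_trans vZ; apply: horner_mx_krylov.
apply/leq_sizeP => j; rewrite leq_eqVlt => /orP[/eqP <-|aj].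
  move/monicP: fm; rewrite coefN coefB coefXn eqxx lead_coefE fs /= => ->.
  by rewrite subrr oppr0.
by rewrite coefN coefB coefXn gtn_eqF // nth_default ?subrr ?oppr0 ?fs.
Qed.

(** For [a > 0] the vector is a row of its Krylov matrix; for [a = 0] the
    polynomial is 1 and the relation itself is the conclusion. *)
Lemma krylov_base Z v f a : f \is monic -> size f = a.+1 ->
  (v *m horner_mx A f <= Z)%MS -> (krylov v a <= Z)%MS -> (v <= Z)%MS.
Proof.
case: a => [|a] fm fs vf vZ; last first.
  by rewrite -[v]mulmx1; move/krylov_subP: vZ => /(_ 0%N); apply.
by have := krylov_top fm fs vf vZ; rewrite mulmx1.
Qed.

Lemma stable_krylov W v a : stablemx W A ->
  (v *m A ^+ a <= W + <<krylov v a>>)%MS -> stablemx (W + <<krylov v a>>)%MS A.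
Proof.
move=> sW va; rewrite addsmxMr addsmx_sub.
rewrite (submx_trans sW) ?addsmxSl //=.
rewrite (eqmxMr _ (genmxE _)); apply/row_subP => j.
rewrite row_mul rowK -mulmxA mulmxE -exprSr.
have := ltn_ord j; rewrite leq_eqVlt => /orP[/eqP -> //|ja].
apply: submx_trans (addsmxSr _ _); rewrite genmxE.
by move/krylov_subP: (submx_refl (krylov v a)); apply.
Qed.

Lemma stable_krylov_monic W v f a : stablemx W A ->
  f \is monic -> size f = a.+1 -> (v *m horner_mx A f <= W)%MS ->
  stablemx (W + <<krylov v a>>)%MS A.
Proof.
move=> sW fm fs vf; apply: stable_krylov => //.
apply: (krylov_top fm fs); first by apply: submx_trans vf (addsmxSl _ _).
by apply: submx_trans (addsmxSr _ _); rewrite genmxE.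
Qed.

Definition krylov_span (l : seq ('rV[k]_n.+1 * nat)) : 'M[k]_n.+1 :=
  (\sum_(p <- l) <<krylov p.1 p.2>>)%MS.

(** The pairs are generators and dimensions of a filtration by [A]-stable
    subspaces, the top step at the head of the list.  When the dimensions
    add up to that of the space, independence of the vectors follows from
    spanning. *)
Fixpoint krylov_tower (l : seq ('rV[k]_n.+1 * nat)) : Prop :=
  if l is p :: l' then (p.1 *m A ^+ p.2 <= krylov_span l)%MS /\ krylov_tower l'
  else True.

Lemma krylov_span_cons p l :
  krylov_span (p :: l) = (<<krylov p.1 p.2>> + krylov_span l)%MS.
Proof. by rewrite /krylov_span big_cons. Qed.

Lemma krylov_tower_stable l : krylov_tower l -> stablemx (krylov_span l) A.
Proof.
elim: l => [_|p l IH [pl /IH sl]]; first by rewrite /krylov_span big_nil stable0mx.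
rewrite krylov_span_cons addsmxC; apply: stable_krylov => //.
by rewrite addsmxC -krylov_span_cons.
Qed.

Lemma krylov_tower_drop t l : krylov_tower l -> krylov_tower (drop t l).
Proof. by elim: l t => [|p l IH] [|t] //= [_ /IH]. Qed.

Lemma krylov_span_rank l :
  (\rank (krylov_span l) <= \sum_(p <- l) p.2)%N.
Proof.
elim: l => [|p l IH]; first by rewrite /krylov_span !big_nil mxrank0.
rewrite krylov_span_cons big_cons; apply: leq_trans (mxrank_adds_leqif _ _) _.
by rewrite leq_add // genmxE rank_leq_row.
Qed.

Lemma mem_krylov_span l p j :
  p \in l -> (j < p.2)%N -> (p.1 *m A ^+ j <= krylov_span l)%MS.
Proof.
move=> pl jp; apply: (@submx_trans _ _ _ _ _ _ <<krylov p.1 p.2>>%MS).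
  by rewrite genmxE; move/krylov_subP: (submx_refl (krylov p.1 p.2)); apply.
elim: l pl => // q l IH; rewrite krylov_span_cons inE => /orP[/eqP <-|/IH pl].
  exact: addsmxSl.
exact: submx_trans pl (addsmxSr _ _).
Qed.

Lemma krylov_span_subP l Z :
  (forall p j, p \in l -> (j < p.2)%N -> (p.1 *m A ^+ j <= Z)%MS) ->
  (krylov_span l <= Z)%MS.
Proof.
elim: l => [|p l IH] sZ; first by rewrite /krylov_span big_nil sub0mx.
rewrite krylov_span_cons addsmx_sub genmxE IH ?andbT; last first.
  by move=> q j ql; apply: sZ; rewrite inE ql orbT.
by apply/krylov_subP => j; apply: sZ; rewrite inE eqxx.
Qed.

End Krylov.

(** Over an algebraically closed field the quotient of [f] by [h] is a product
    of linear factors; multiply [h] by as many of them as the degree asks for. *)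
Lemma monic_divisor_between (k : closedFieldType) (f h : {poly k}) m :
  f \is monic -> h \is monic -> h %| f ->
  ((size h).-1 <= m <= (size f).-1)%N ->
  exists g, [/\ g \is monic, h %| g, g %| f & size g = m.+1].
Proof.
move=> fm hm /dvdpP[r fE] /andP[hm_le m_le].
have rm : r \is monic by rewrite -(monicMr _ hm) -fE.
have h0 := monic_neq0 hm; have r0 := monic_neq0 rm.
have [s rE] := closed_field_poly_normal r.
rewrite (monicP rm) scale1r in rE.
have szr : size r = (size s).+1 by rewrite rE size_prod_XsubC.
have szf : size f = (size s + size h)%N.
  by rewrite fE size_mul // szr addSn.
have szh : (0 < size h)%N by rewrite lt0n size_poly_eq0.
exists ((\prod_(c <- take (m - (size h).-1) s) ('X - c%:P)) * h).
have pm : \prod_(c <- take (m - (size h).-1) s) ('X - c%:P) \is monic.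
  by rewrite monic_prod_XsubC.
split.
- by rewrite monicMr.
- exact: dvdp_mull.
- rewrite fE rE dvdp_mul // -{2}(cat_take_drop (m - (size h).-1) s) big_cat.
  exact: dvdp_mulIl.
- rewrite size_mul ?monic_neq0 // size_prod_XsubC size_takel.
    by rewrite -[in LHS](prednK szh) addSn addnS /= subnK.
  by rewrite leq_subLR; move: m_le; rewrite szf -[X in (_ + X)%N](prednK szh) addnS addnC.
Qed.

(** * Dominance and peeling off one part *)

(** Dominance without sorting: the largest sum of [m] entries of [la] is reached
    on its [m] largest entries, so quantifying over all subsequences compares
    the sorted list, while removing an arbitrary entry stays easy. *)
Definition dominates (nu la : seq nat) : Prop :=
  forall s, subseq s la -> (sumn s <= sumn (take (size s) nu))%N.

(** A selection [s] with more than [size p] entries is compared through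
    [a :: s], which costs [a] and takes one more part of the dominating
    sequence; a shorter one is untouched by the merging of [d] and [e]. *)
Lemma dominates_step p d e r a la : (e <= a <= d)%N ->
  dominates (p ++ [:: d, e & r]) (a :: la) ->
  dominates (p ++ (d + e - a)%N :: r) la.
Proof.
move=> /andP[ea ad] D s sla; case: (leqP (size s) (size p)) => [sp|ps].
  have := D s (subseq_trans sla (subseq_cons _ _)).
  by rewrite !takel_cat.
have := D (a :: s); rewrite /= eqxx => /(_ sla).
rewrite !take_cat !(ltnNge _ (size p)) (ltnW ps) leqW ?(ltnW ps) //=.
by rewrite subSn ?(ltnW ps) // -(subnSK ps) /= !sumn_cat /=; lia.
Qed.

Lemma dominates_pad nu la : dominates nu la -> dominates (rcons nu 0%N) la.
Proof.
move=> D s /D /leq_trans; apply; rewrite -cats1 take_cat; case: ifP => // sn.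
by rewrite sumn_cat take_oversize ?leq_addr // leqNgt sn.
Qed.

Section CyclicChain.
Variables (k : closedFieldType) (n : nat) (A : 'M[k]_n.+1).
Implicit Types zs : seq ('rV[k]_n.+1 * {poly k}).

Definition zdeg (z : 'rV[k]_n.+1 * {poly k}) := (size z.2).-1.

(** Generators with annihilating polynomials in the order of invariant factors.
    The degrees bound the dimensions from above; they become exact when their
    sum is the dimension of the space that the vectors generate. *)
Definition cyclic_chain zs : Prop :=
  {in zs, forall z, z.2 \is monic /\ z.1 *m horner_mx A z.2 = 0} /\
  pairwise (fun z y => y.2 %| z.2) zs.

Lemma cyclic_chain_pad zs : cyclic_chain zs -> cyclic_chain (rcons zs (0, 1)).
Proof.
case=> zK zP; split=> [z|].
  by rewrite mem_rcons inE => /orP[/eqP -> /=|/zK //]; rewrite monic1 mul0mx.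
rewrite -cats1 pairwise_cat zP /= andbT allrel1r; apply/allP => z _ /=.
exact: dvd1p.
Qed.

(** Modulo a stable subspace [W] containing the new generator
    [x.1 = q(A) z + y], where [z.2 = q * x.2], the vectors [y] and [- q(A) z]
    agree; hence [z] generates [y], and [q * y.2], of degree [a], kills [z]. *)
Lemma cyclic_chain_peel s1 z y s2 a :
  (zdeg y <= a <= zdeg z)%N -> cyclic_chain (s1 ++ [:: z, y & s2]) ->
  exists x, [/\ zdeg x = (zdeg z + zdeg y - a)%N,
    cyclic_chain (s1 ++ x :: s2) &
    forall W : 'M[k]_n.+1, stablemx W A -> (x.1 <= W)%MS ->
      (exists2 f, f \is monic /\ size f = a.+1 & (z.1 *m horner_mx A f <= W)%MS)
      /\ (forall Z : 'M[k]_n.+1, stablemx Z A -> (W <= Z)%MS -> (z.1 <= Z)%MS ->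
            (y.1 <= Z)%MS)].
Proof.
move=> /andP[ya az] [zK].
rewrite pairwise_cat /= !allrel_consr => /and3P[/and3P[s1z s1y s12] ps1].
move=> /and3P[/andP[zy zs2] ys2 ps2].
have [|zm zk] := zK z; first by rewrite mem_cat !inE eqxx orbT.
have [|ym yk] := zK y; first by rewrite mem_cat !inE eqxx !orbT.
have [g [gm yg gz gs]] : exists g, [/\ g \is monic, y.2 %| g, g %| z.2
    & size g = (zdeg z + zdeg y - a).+1].
  apply: monic_divisor_between => //; rewrite -/(zdeg z) -/(zdeg y); lia.
have /dvdpP[q zE] := gz.
have qm : q \is monic by rewrite -(monicMr _ gm) -zE.
exists (z.1 *m horner_mx A q + y.1, g); split=> /=.
- by rewrite /zdeg /= gs.
- split=> [x|].
    rewrite mem_cat inE => /or3P[xs|/eqP -> /=|xs]; last 1 first.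
    + by apply: zK; rewrite mem_cat !inE xs !orbT.
    + by apply: zK; rewrite mem_cat xs.
    split=> //; rewrite mulmxDl -mulmxA mulmxE -rmorphM -zE zk add0r.
    have /dvdpP[r ->] := yg.
    by rewrite mulrC rmorphM -mulmxE mulmxA yk mul0mx.
  rewrite pairwise_cat /= allrel_consr s12 ps1 ps2 !andbT.
  apply/andP; split; apply/allP => x xs /=.
    by apply: dvdp_trans gz _; move/allP: s1z => /(_ x xs).
  by apply: dvdp_trans yg; move/allP: ys2 => /(_ x xs).
- move=> W sW xW; split=> [|Z sZ WZ zZ].
    (* deg q + deg y.2 = deg z.2 - deg g + deg y.2 = a. *)
    exists (q * y.2).
      split; first by rewrite monicMl.
      have q0 := monic_neq0 qm; have y0 := monic_neq0 ym; have g0 := monic_neq0 gm.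
      have : size z.2 = (size q + size g).-1 by rewrite zE size_mul.
      rewrite (size_mul q0 y0) gs; move: (monic_neq0 zm) q0 y0 ya az; rewrite /zdeg.
      rewrite -!size_poly_gt0; clear.
      by move: (size z.2) (size q) (size y.2) => *; lia.
    have -> : z.1 *m horner_mx A (q * y.2)
       = (z.1 *m horner_mx A q + y.1) *m horner_mx A y.2.
      by rewrite mulmxDl yk addr0 -mulmxA mulmxE -rmorphM.
    exact: horner_mx_sub.
  have -> : y.1 = (z.1 *m horner_mx A q + y.1) - z.1 *m horner_mx A q.
    by rewrite addrC addKr.
  by rewrite addmx_sub ?(submx_trans xW) // eqmx_opp horner_mx_sub.
Qed.

Lemma split_at_degree zs a : (0 < a)%N -> (a <= head 0 (map zdeg zs))%N ->
  exists s1 z s2, [/\ zs = s1 ++ z :: s2, (a <= zdeg z)%N &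
                      (head 0 (map zdeg s2) <= a)%N].
Proof.
move=> a0; elim: zs => [|z zs IH] /=; first by rewrite leqNgt a0.
move=> az; case: (leqP a (head 0 (map zdeg zs))) => [/IH|/ltnW za].
  by case=> s1 [z' [s2 [-> az' hs2]]]; exists (z :: s1), z', s2.
by exists [::], z, zs.
Qed.

(** Induction on [la], whose head is the top quotient of the filtration. *)
Lemma krylov_tower_exists la zs : all (leq 1) la -> cyclic_chain zs ->
  dominates (map zdeg zs) la -> (sumn (map zdeg zs) <= sumn la)%N ->
  exists ys, [/\ size ys = size la, krylov_tower A (zip ys la) &
    {in zs, forall z, (z.1 <= krylov_span A (zip ys la))%MS}].
Proof.
elim: la zs => [|a la IH] zs /=.
  move=> _ [zK _] _ sz; exists [::]; split=> // z zz.
  have [zm zk] := zK z zz.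
  (* All degrees vanish, so the annihilating polynomials are constants. *)
  have z1 : size z.2 = 1%N.
    have : zdeg z = 0%N.
      apply/eqP; rewrite -leqn0; apply: leq_trans sz.
      by rewrite (perm_sumn (perm_map zdeg (perm_to_rem zz))) leq_addr.
    move/monic_neq0: zm; rewrite -size_poly_gt0 /zdeg.
    by case: (size z.2) => // j _ /= ->.
  move/eqP/size_poly1P: z1 => [c c0 cE].
  move: zk; rewrite cE horner_mx_C mul_mx_scalar => /eqP.
  by rewrite scaler_eq0 (negPf c0) /= => /eqP ->; rewrite sub0mx.
move=> /andP[a0 la0] zsc D szs.
have := D [:: a]; rewrite sub1seq inE eqxx => /(_ isT); rewrite /= addn0.
have -> : sumn (take 1 (map zdeg zs)) = head 0%N (map zdeg zs).
  by case: (zs) => //= z s; rewrite take0 /= addn0.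
have peel s1 z y s2 : (zdeg y <= a <= zdeg z)%N ->
    cyclic_chain (s1 ++ [:: z, y & s2]) ->
    dominates (map zdeg (s1 ++ [:: z, y & s2])) (a :: la) ->
    (sumn (map zdeg (s1 ++ [:: z, y & s2])) <= a + sumn la)%N ->
    exists ys, [/\ size ys = (size la).+1, krylov_tower A (zip ys (a :: la)) &
    {in s1 ++ [:: z, y & s2], forall z,
      (z.1 <= krylov_span A (zip ys (a :: la)))%MS}].
  move=> yaz sc sD ssum; have [x [dx xc xW]] := cyclic_chain_peel yaz sc.
  have [||ys [sys tys zys]] := IH (s1 ++ x :: s2) la0 xc.
  - by move: sD; rewrite !map_cat /= dx; apply: dominates_step.
  - move: ssum; rewrite !map_cat !sumn_cat /= dx; clear -yaz; lia.
  set W := krylov_span A (zip ys la) in zys.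
  have sW : stablemx W A by exact: krylov_tower_stable.
  have [|[f [fm fs] fW] yZ] := xW W sW.
    by apply: zys; rewrite mem_cat mem_head orbT.
  have WZ : (W <= krylov_span A ((z.1, a) :: zip ys la))%MS.
    by rewrite krylov_span_cons addsmxSr.
  have ty : krylov_tower A (zip (z.1 :: ys) (a :: la)).
    split=> //=; apply: (krylov_top fm fs); first exact: submx_trans fW WZ.
    by rewrite krylov_span_cons -(genmxE (krylov _ _ _)) addsmxSl.
  have zZ : (z.1 <= krylov_span A ((z.1, a) :: zip ys la))%MS.
    have := @mem_krylov_span _ _ A ((z.1, a) :: zip ys la) (z.1, a) 0.
    by rewrite mem_head expr0 mulmx1; apply.
  exists (z.1 :: ys); split=> //=; first by rewrite sys.
  move=> t; rewrite mem_cat !inE => /or4P[ts|/eqP->|/eqP->|ts] //.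
  + by apply: submx_trans WZ; apply: zys; rewrite mem_cat ts.
  + by apply: yZ => //; exact: krylov_tower_stable ty.
  + by apply: submx_trans WZ; apply: zys; rewrite mem_cat inE ts !orbT.
move=> /(split_at_degree a0) [s1 [z [[|y s2] [zsE az]]]] /=.
  (* The last generator is peeled against the zero vector, killed by 1. *)
  have zsE' : rcons zs (0, 1) = s1 ++ [:: z; (0, 1)] by rewrite zsE -!cats1 -catA.
  move=> _; have [|||| ys [sys tys zys]] := peel s1 z (0, 1) [::].
  - by rewrite /zdeg /= size_poly1.
  - by rewrite -zsE'; exact: cyclic_chain_pad.
  - rewrite -zsE' map_rcons /zdeg /= size_poly1; exact: dominates_pad.
  - by rewrite -zsE' map_rcons -cats1 sumn_cat /zdeg /= size_poly1 !addn0.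
  exists ys; split=> // t tz; apply: zys; rewrite -zsE'.
  by rewrite mem_rcons inE tz orbT.
move=> ya; rewrite zsE in zsc D szs *; apply: peel => //.
by rewrite ya.
Qed.

End CyclicChain.

(** * Invariant factors from the Jordan form *)

Section JordanChain.
Variables (k : closedFieldType) (n : nat) (A : 'M[k]_n.+1).

(** The first row generates: [A - c] maps each row to the next one and kills the
    last. *)
Lemma jordan_block_cyclic c m (Q : 'M[k]_(m, n.+1)) :
  (0 < m)%N -> Q *m A = jordan_block c m *m Q ->
  exists x : 'rV[k]_n.+1, x *m horner_mx A (('X - c%:P) ^+ m) = 0 /\
    forall Z : 'M[k]_n.+1, stablemx Z A -> (x <= Z)%MS -> (Q <= Z)%MS.
Proof.
case: m Q => // m Q _ QA; pose B := horner_mx A ('X - c%:P).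
have BE : Q *m B = (\matrix_(i, j) (i.+1 == j :> nat)%:R) *m Q.
  rewrite /B rmorphB /= horner_mx_X horner_mx_C mulmxBr QA mul_mx_scalar.
  rewrite -mul_scalar_mx -mulmxBl; congr (_ *m _); apply/matrixP => i j.
  by rewrite !mxE addrC addKr.
have row_next (r s : 'I_m.+1) : r.+1 = s -> row r Q *m B = row s Q.
  move=> rs; rewrite -row_mul BE row_mul [RHS]rowE; congr (_ *m _).
  by apply/rowP => j; rewrite !mxE eqxx rs eq_sym.
have rowB r : (r <= m)%N -> row ord0 Q *m B ^+ r = row (inord r) Q.
  elim: r => [|r IH] rm.
    by rewrite expr0 mulmx1; congr (row _ _); apply: val_inj; rewrite /= inordK.
  rewrite exprSr -mulmxE mulmxA IH 1?ltnW //; apply: row_next.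
  by rewrite !inordK // ltnS ltnW.
exists (row ord0 Q); split=> [|Z sZ xZ].
  rewrite rmorphXn /= -/B exprSr -mulmxE mulmxA rowB //.
  rewrite -row_mul BE row_mul (_ : row _ _ = 0) ?mul0mx //.
  by apply/rowP => j; rewrite !mxE inordK // eq_sym ltn_eqF.
apply/row_subP => r; rewrite -[r]inord_val -rowB -1?ltnS //.
by rewrite -rmorphXn /=; exact: horner_mx_sub.
Qed.

Lemma jordan_form_cyclic js : jordan_form A js ->
  exists bs : seq ('rV[k]_n.+1 * (k * nat)), [/\ map snd bs = js,
    {in bs, forall b, b.1 *m horner_mx A (('X - b.2.1%:P) ^+ b.2.2) = 0} &
    forall Z : 'M[k]_n.+1, stablemx Z A -> {in bs, forall b, (b.1 <= Z)%MS} ->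
      row_full Z].
Proof.
case=> /allP js0 [P [Pfree Pfull PA]].
pose t i := tnth (in_tuple js) i.
have tj i : t i \in js by exact: mem_tnth.
have QA i : submxcol P i *m A = jordan_block (t i).1 (t i).2 *m submxcol P i.
  rewrite submxcol_mul PA /jordan_mx -{1}[P]submxcolK mul_mxdiag_mxcol mxcolK.
  by [].
have [x xP] := fin_all_exists (fun i => jordan_block_cyclic (js0 _ (tj i)) (QA i)).
exists [seq (x i, t i) | i <- enum 'I_(size js)]; split.
- by rewrite -map_comp; exact: (map_tnth_enum (in_tuple js)).
- by move=> b /mapP[i _ ->] /=; case: (xP i).
move=> Z sZ xZ; rewrite -sub1mx; apply: (@submx_trans _ _ _ _ _ _ P).
  by rewrite sub1mx.
apply/row_subP => r; rewrite -[P]submxcolK row_mxcol.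
apply: submx_trans (row_sub _ _) _; case: (xP (tagnat.sig1 r)) => _; apply=> //.
by apply: (xZ (x (tagnat.sig1 r), t (tagnat.sig1 r))); rewrite map_f ?mem_enum.
Qed.

Lemma size_jordan_form js : jordan_form A js -> (\sum_(p <- js) p.2 = n.+1)%N.
Proof.
case=> _ [P [/eqP Pfree /eqP Pfull _]].
exact: etrans (big_tnth _ _ _ _ _) (etrans (esym Pfree) Pfull).
Qed.

End JordanChain.

Lemma sum_nth_take s m : (\sum_(i < m) nth 0 s i)%N = sumn (take m s).
Proof.
elim: s m => [|x s IH] [|m] //=; rewrite ?big_ord0 ?take0 //.
  by rewrite big1 // => i _; rewrite nth_nil.
by rewrite big_ord_recl /= IH.
Qed.

Section Xi.
Variables (k : closedFieldType).
Implicit Type js : seq (k * nat).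

Lemma size_block_sizes js c : c \in eigs js ->
  (size (block_sizes js c) <= size (xi js))%N.
Proof.
move=> cj; rewrite size_mkseq.
exact: (@leq_bigmax_seq _ _ xpredT (fun e => size (block_sizes js e))).
Qed.

Lemma sumn_xi js : sumn (xi js) = (\sum_(p <- js) p.2)%N.
Proof.
rewrite -[xi js in LHS]take_size -sum_nth_take.
transitivity (\sum_(t < size (xi js))
    \sum_(c <- eigs js) nth 0 (block_sizes js c) t)%N.
  apply: eq_bigr => t _; rewrite nth_mkseq //.
  by have := ltn_ord t; rewrite [X in (_ < X)%N]size_mkseq.
rewrite exchange_big /=.
transitivity (\sum_(c <- eigs js) \sum_(p <- js | p.1 == c) p.2)%N.
  rewrite big_seq [RHS]big_seq; apply: eq_bigr => c cj.
  rewrite sum_nth_take take_oversize ?size_block_sizes //.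
  rewrite (perm_sumn (permEl (perm_sort _ _))).
  by rewrite sumnE big_map big_filter.
rewrite (exchange_big_dep predT) //= big_seq [RHS]big_seq; apply: eq_bigr => p pj.
rewrite (big_rem p.1) /= ?mem_undup ?map_f // eqxx big_seq_cond big1 ?addn0 // => c.
rewrite mem_rem_uniq ?undup_uniq // inE.
by move=> /andP[/andP[/= /negPf + _] /eqP pc]; rewrite pc eqxx.
Qed.

Lemma block_sizes_anti js c i j : (i <= j)%N ->
  (nth 0 (block_sizes js c) j <= nth 0 (block_sizes js c) i)%N.
Proof.
move=> ij; have [sj|js_] := leqP (size (block_sizes js c)) j.
  by rewrite nth_default.
have st : sorted geq (block_sizes js c) by apply: sort_sorted => a b; exact: leq_total.
apply: (sorted_leq_nth _ _ _ st) => //.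
- by move=> a b d ba cb; exact: leq_trans cb ba.
- by move=> a; exact: leqnn.
- by rewrite inE (leq_ltn_trans ij).
Qed.

(** The Chinese remainder theorem: the product of the other annihilators is
    invertible modulo the power of ['X - c], so a polynomial in [A] extracts
    [x c] from the sum. *)
Lemma coprime_summands_mem n (A Z : 'M[k]_n.+1) (cs : seq k)
    (x : k -> 'rV[k]_n.+1) (N : k -> nat) :
  uniq cs -> {in cs, forall c, x c *m horner_mx A (('X - c%:P) ^+ N c) = 0} ->
  stablemx Z A -> ((\sum_(c <- cs) x c)%R <= Z)%MS ->
  {in cs, forall c, (x c <= Z)%MS}.
Proof.
move=> ucs xK sZ xZ c cs_c.
pose F := \prod_(e <- rem c cs) ('X - e%:P) ^+ N e.
have killF e : e \in rem c cs -> x e *m horner_mx A F = 0.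
  move=> ec; rewrite /F (perm_big _ (perm_to_rem ec)) big_cons rmorphM.
  by rewrite -mulmxE mulmxA xK ?mul0mx // (mem_rem ec).
have /Bezout_eq1_coprimepP[u uE] : coprimep F (('X - c%:P) ^+ N c).
  apply: coprimep_expr; rewrite coprimep_XsubC /root horner_prod.
  rewrite prodf_seq_neq0; apply/allP => e; rewrite mem_rem_uniq // => /andP[/= ec _].
  by rewrite !hornerE expf_neq0 // subr_eq0 eq_sym.
have -> : x c = (\sum_(e <- cs) x e) *m horner_mx A (F * u.1).
  rewrite (perm_big _ (perm_to_rem cs_c)) big_cons mulmxDl mulmx_suml.
  rewrite [X in _ + X]big_seq [X in _ + X]big1 ?addr0; last first.
    by move=> e er; rewrite rmorphM -mulmxE mulmxA killF // mul0mx.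
  transitivity (x c *m horner_mx A 1); first by rewrite rmorph1 mulmx1.
  rewrite -uE rmorphD mulmxDr /=.
  rewrite [u.2 * _]mulrC [in X in _ + X]rmorphM -mulmxE [in X in _ + X]mulmxA xK //.
  by rewrite mul0mx addr0 mulrC.
exact: horner_mx_sub.
Qed.

(** The [t]-th generator adds the generators of the [t]-th largest blocks of all
    eigenvalues; past the last block of an eigenvalue the default contributes
    the zero vector, killed by [('X - c) ^+ 0]. *)
Lemma cyclic_chain_of_jordan n (A : 'M[k]_n.+1) js : jordan_form A js ->
  exists zs, [/\ cyclic_chain A zs, map (@zdeg _ _) zs = xi js &
    forall Z : 'M[k]_n.+1, stablemx Z A -> {in zs, forall z, (z.1 <= Z)%MS} ->
      row_full Z].
Proof.
move=> /jordan_form_cyclic[bs [bsE bsK bsZ]].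
pose B c := sort (relpre (fun b : 'rV[k]_n.+1 * (k * nat) => b.2.2) geq)
  [seq b <- bs | b.2.1 == c].
have BE c : [seq b.2.2 | b <- B c] = block_sizes js c.
  by rewrite /block_sizes -bsE filter_map -map_comp sort_map.
pose b0 : 'rV[k]_n.+1 * (k * nat) := (0, (0, 0%N)).
pose x t c := (nth b0 (B c) t).1; pose N t c := nth 0%N (block_sizes js c) t.
have xK t c : x t c *m horner_mx A (('X - c%:P) ^+ N t c) = 0.
  rewrite /x /N; have [st|ts] := leqP (size (B c)) t.
    by rewrite nth_default // mul0mx.
  have := mem_nth b0 ts; rewrite mem_sort mem_filter => /andP[/eqP cE /bsK].
  by rewrite cE -BE (nth_map b0).
pose z t := (\sum_(c <- eigs js) x t c, \prod_(c <- eigs js) ('X - c%:P) ^+ N t c).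
exists (mkseq z (size (xi js))); split.
- split=> [_ /mapP[t _ ->] /=|].
    split; first by rewrite monic_prod // => c _; rewrite monic_exp ?monicXsubC.
    rewrite mulmx_suml big_seq big1 // => c cj.
    rewrite (perm_big _ (perm_to_rem cj)) big_cons rmorphM -mulmxE mulmxA.
    by rewrite xK mul0mx.
  rewrite pairwise_map; apply: sub_pairwise (_ : pairwise ltn _).
    move=> i j /= /ltnW ij; elim/big_rec2: _ => // c p q _ pq.
    by rewrite dvdp_mul // dvdp_exp2l // block_sizes_anti.
  by rewrite -sorted_pairwise ?iota_ltn_sorted //; exact: ltn_trans.
- rewrite -map_comp [RHS]/xi size_mkseq; apply: eq_map => t /=.
  rewrite /zdeg /= size_prod_seq; last first.
    by move=> c _; rewrite expf_neq0 ?polyXsubC_eq0.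
  have -> : (\sum_(c <- eigs js) size (('X - c%:P) ^+ N t c)
             = \sum_(c <- eigs js) (N t c + 1))%N.
    by apply: eq_bigr => c _; rewrite size_exp_XsubC addn1.
  by rewrite big_split /= sum1_size -addSn addnK.
move=> Z sZ zZ; apply: bsZ => // b bbs.
have bB : b \in B b.2.1 by rewrite mem_sort mem_filter eqxx.
have bj : b.2.1 \in eigs js by rewrite mem_undup -bsE -map_comp; apply/mapP; exists b.
have tlt : (index b (B b.2.1) < size (xi js))%N.
  apply: leq_trans (size_block_sizes bj).
  by rewrite -BE size_map index_mem.
have -> : b.1 = x (index b (B b.2.1)) b.2.1 by rewrite /x nth_index.
apply: (coprime_summands_mem (undup_uniq _) _ sZ _ bj) => //.
by apply: (zZ (z (index b (B b.2.1)))); rewrite map_f // mem_iota.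
Qed.

End Xi.

(** * Positions along the cycles, counted from their minima *)

Section CycleMinima.
Variables (n : nat) (w : 'S_n.+1).

Definition cycle_min (j : 'I_n.+1) : 'I_n.+1 :=
  [arg min_(i < j | i \in porbit w j) (i : nat)].

Definition cycle_minima : seq 'I_n.+1 :=
  [seq i <- enum 'I_n.+1 | cycle_min i == i].

Lemma cycle_min_porbit j : porbit w (cycle_min j) = porbit w j.
Proof.
apply/eqP; rewrite eq_porbit_mem /cycle_min.
by case: arg_minnP => //; exact: porbit_id.
Qed.

Lemma cycle_min_le j i : i \in porbit w j -> (cycle_min j <= i)%N.
Proof.
rewrite /cycle_min; case: arg_minnP => [|m _ mP ij]; first exact: porbit_id.
exact: mP.
Qed.

Lemma eq_cycle_min i j : porbit w i = porbit w j -> cycle_min i = cycle_min j.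
Proof.
move=> ij; apply: val_inj; apply/eqP; rewrite eqn_leq !cycle_min_le //.
  by rewrite -ij -cycle_min_porbit porbit_id.
by rewrite ij -cycle_min_porbit porbit_id.
Qed.

Lemma cycle_min_mem j : cycle_min j \in cycle_minima.
Proof.
by rewrite mem_filter mem_enum andbT; apply/eqP/eq_cycle_min/cycle_min_porbit.
Qed.

Lemma cycle_minP m : m \in cycle_minima -> cycle_min m = m.
Proof. by rewrite mem_filter => /andP[/eqP]. Qed.

Lemma cycle_minima_uniq : uniq cycle_minima.
Proof. by rewrite filter_uniq ?enum_uniq. Qed.

Lemma cycle_minima_sorted : sorted (fun i j : 'I_n.+1 => (i < j)%N) cycle_minima.
Proof.
apply: sorted_filter; first by move=> a b c; exact: ltn_trans.
have := iota_ltn_sorted 0 n.+1; rewrite -val_enum_ord.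
by rewrite sorted_map.
Qed.

Lemma perm_cycle_minima :
  perm_eq [seq porbit w m | m <- cycle_minima] (enum (porbits w)).
Proof.
apply: uniq_perm; rewrite ?enum_uniq //.
  rewrite map_inj_in_uniq ?cycle_minima_uniq // => i j.
  by move=> /cycle_minP {2}<- /cycle_minP {2}<- /eq_cycle_min.
move=> X; rewrite mem_enum; apply/mapP/imsetP => [[m _ ->]|[j _ ->]].
  by exists m.
by exists (cycle_min j); rewrite ?cycle_min_mem ?cycle_min_porbit.
Qed.

(** The position of [j] on the backward orbit of the element that [w] sends to
    the minimum: the minimum itself comes last on its cycle. *)
Definition cycle_pos (j : 'I_n.+1) : nat :=
  index j (traject w^-1%g (w^-1%g (cycle_min j)) #|porbit w j|).

Lemma traject_cycle_min j :
  let tr := traject w^-1%g (w^-1%g (cycle_min j)) #|porbit w j| in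
  uniq tr /\ tr =i porbit w j.
Proof.
have E : porbit w^-1 (w^-1%g (cycle_min j)) = porbit w j.
  have := porbit_perm w^-1 1 (cycle_min j).
  by rewrite expg1 !porbitV cycle_min_porbit.
rewrite -E; split; first exact: uniq_traject_porbit.
by move=> i; rewrite -porbit_traject.
Qed.

Lemma cycle_pos_lt j : (cycle_pos j < #|porbit w j|)%N.
Proof.
have [_ trE] := traject_cycle_min j.
rewrite -[X in (_ < X)%N](size_traject w^-1%g (w^-1%g (cycle_min j))).
by rewrite index_mem trE porbit_id.
Qed.

Lemma iter_cycle_pos j : iter (cycle_pos j) w^-1%g (w^-1%g (cycle_min j)) = j.
Proof.
have [_ trE] := traject_cycle_min j.
by rewrite -(@nth_traject _ w^-1%g _ _ (cycle_pos_lt j)) nth_index // trE porbit_id.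
Qed.

Lemma cycle_min_iter m e : m \in cycle_minima ->
  cycle_min (iter e w^-1%g (w^-1%g m)) = m.
Proof.
move=> mr; rewrite -[RHS](cycle_minP mr); apply: eq_cycle_min.
by rewrite -iterSr -permX -[porbit w _]porbitV porbit_perm porbitV.
Qed.

Lemma cycle_pos_iter m e : m \in cycle_minima -> (e < #|porbit w m|)%N ->
  cycle_pos (iter e w^-1%g (w^-1%g m)) = e.
Proof.
move=> mr em; set j := iter _ _ _; have jm : cycle_min j = m := cycle_min_iter e mr.
have jo : porbit w j = porbit w m by rewrite -jm cycle_min_porbit.
rewrite /cycle_pos jm jo /j -(nth_traject w^-1%g em) index_uniq ?size_traject //.
by have [] := traject_cycle_min m; rewrite cycle_minP.
Qed.

Lemma cycle_pos_last j : (cycle_pos j).+1 = #|porbit w j| -> cycle_min j = j.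
Proof.
move=> ej; have := iter_cycle_pos j; rewrite -iterSr ej.
by rewrite -cycle_min_porbit -[porbit w _]porbitV iter_porbit.
Qed.

Lemma cycle_pos_next j : ((cycle_pos j).+1 < #|porbit w j|)%N ->
  cycle_min (w^-1%g j) = cycle_min j /\ cycle_pos (w^-1%g j) = (cycle_pos j).+1.
Proof.
move=> ej; rewrite -{1 3}(iter_cycle_pos j) -iterS.
by rewrite cycle_min_iter ?cycle_pos_iter ?cycle_min_mem ?cycle_min_porbit.
Qed.

End CycleMinima.

(** * From a filtration to a Bruhat cell *)

Lemma closed_root_exists (k : closedFieldType) (n : nat) (c : k) :
  exists d, d ^+ n.+1 = c.
Proof.
have /closed_rootP[d dr] : size ('X^(n.+1) - c%:P) != 1%N by rewrite size_XnsubC.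
by exists d; apply/eqP; rewrite -subr_eq0; move: dr; rewrite /root !hornerE.
Qed.

Section Bruhat.
Variables (k : closedFieldType) (n : nat) (w : 'S_n.+1).

(** The matrix [X] times the inverse of a representative of [w] is upper
    triangular; scaling the permutation matrix by an [n.+1]-th root of its
    determinant puts it in the special linear group. *)
Lemma in_BwB_upper (X : 'M[k]_n.+1) :
  \det X = 1 -> (forall i l : 'I_n.+1, (w l < i)%N -> X i l = 0) -> in_BwB w X.
Proof.
move=> X1 X0; have [d dE] := closed_root_exists n (\det (perm_mx w : 'M[k]_n.+1)).
have d0 : d != 0.
  apply: contraTneq (oner_neq0 k) => d0; move: dE; rewrite d0 expr0n /= => /esym.
  by rewrite det_perm => /eqP; rewrite signr_eq0.
pose D : 'M[k]_n.+1 := d *: perm_mx w^-1.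
pose E : 'M[k]_n.+1 := d^-1 *: perm_mx w.
have ED : E *m D = 1.
  by rewrite -scalemxAl -scalemxAr scalerA mulVf // scale1r -perm_mxM mulgV perm_mx1.
have D1 : \det D = 1.
  by rewrite detZ dE -det_mulmx -perm_mxM mulgV perm_mx1 det1.
have E1 : \det E = 1 by have := det1 k n.+1; rewrite -[1%:M]ED det_mulmx D1 mulr1.
exists (X *m E), D, 1%:M; split.
- split; first by rewrite det_mulmx X1 E1 mulr1.
  apply/is_trig_mxP => i j ij; rewrite mxE -scalemxAr -[w]invgK -col_permE.
  by rewrite !mxE X0 ?mulr0 // permKV.
- split=> // i j; rewrite !mxE mulf_eq0 (negPf d0) /=.
  rewrite -(inj_eq (@perm_inj _ w)) permKV; case: (i == w j); last by rewrite eqxx.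
  exact: oner_neq0.
- by split; [rewrite det1 | rewrite trmx1 scalar_mx_is_trig].
- by rewrite mulmx1 -mulmxA ED mulmx1.
Qed.

(** The row [j] of the new basis is the [cycle_pos w j]-th image of the
    generator attached to the cycle of [j].  Its image under [A] is the row
    [w^-1 j] unless [j] is the minimum of its cycle, and then it lies in the
    span of the rows of the cycles with minimum at least [j]; in both cases only
    rows [l] with [j <= w l] occur. *)
Lemma bruhat_of_tower (A : 'M[k]_n.+1) (ys : seq 'rV[k]_n.+1) :
  let l := zip ys [seq #|porbit w m| | m <- cycle_minima w] in
  size ys = size (cycle_minima w) -> \det A = 1 ->
  krylov_tower A l -> row_full (krylov_span A l) ->
  exists g, \det g = 1 /\ in_BwB w (g *m A *m invmx g).
Proof.
move=> l sys A1 tl fl.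
pose a (m : 'I_n.+1) := #|porbit w m|; pose cs := cycle_minima w.
pose y m : 'rV[k]_n.+1 := nth 0 ys (index m cs).
pose G : 'M[k]_n.+1 := \matrix_j (y (cycle_min w j) *m A ^+ cycle_pos w j).
have rowG m e : m \in cs -> (e < a m)%N ->
    row (iter e w^-1%g (w^-1%g m)) G = y m *m A ^+ e.
  by move=> mcs ea; rewrite rowK cycle_min_iter ?cycle_pos_iter.
have szl : size l = size cs by rewrite size_zip size_map sys minnn.
have nthl m : m \in cs -> nth (0, 0%N) l (index m cs) = (y m, a m).
  move=> mcs; rewrite nth_zip ?size_map // (nth_map m) ?index_mem //.
  by rewrite nth_index.
have mem_drop t p : p \in drop t l ->
    exists m, [/\ m \in cs, (t <= index m cs)%N & p = (y m, a m)].
  move=> /(nthP (0, 0%N))[i]; rewrite size_drop ltn_subRL nth_drop szl => ti <-.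
  exists (nth ord0 cs (t + i)).
  by rewrite -nthl mem_nth // index_uniq ?cycle_minima_uniq ?leq_addr.
have Gu : G \in unitmx.
  rewrite -row_full_unit -sub1mx; apply: submx_trans (_ : (krylov_span A l <= G)%MS).
    by rewrite sub1mx.
  apply: krylov_span_subP => p j; rewrite -[l]drop0 => /mem_drop[m [mcs _ ->]] /= ja.
  by rewrite -rowG // row_sub.
pose D (i : 'I_n.+1) : 'M[k]_n.+1 := diag_mx (\row_l (i <= w l)%:R).
have rowD (i j : 'I_n.+1) : (i <= w j)%N -> (row j G <= D i *m G)%MS.
  move=> ij; suff -> : row j G = row j (D i *m G) by exact: row_sub.
  by apply/rowP => t; rewrite mul_diag_mx !mxE ij mul1r.
have GA i : (row i G *m A <= D i *m G)%MS.
  have [ei|ei] := ltnP (cycle_pos w i).+1 (a i).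
    have [mi pi] := cycle_pos_next ei.
    have -> : row i G *m A = row (w^-1%g i) G.
      by rewrite !rowK mi pi -mulmxA mulmxE -exprSr.
    by apply: rowD; rewrite permKV.
  have {}ei : (cycle_pos w i).+1 = a i.
    by apply/eqP; rewrite eqn_leq ei andbT cycle_pos_lt.
  have mi := cycle_pos_last ei.
  have ics : i \in cs by rewrite -mi cycle_min_mem.
  have -> : row i G *m A = y i *m A ^+ a i.
    by rewrite rowK mi -mulmxA mulmxE -exprSr ei.
  have idx : (index i cs < size l)%N by rewrite szl index_mem.
  have := krylov_tower_drop (index i cs) tl.
  rewrite (drop_nth (0, 0%N) idx) nthl // => -[/= ya _]; apply: submx_trans ya _.
  rewrite -nthl // -(drop_nth _ idx).
  apply: krylov_span_subP => p j /mem_drop[m [mcs im ->]] /= ja.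
  rewrite -rowG //; apply: rowD.
  have le_im : (i <= m)%N.
    rewrite -(nth_index i ics) -(nth_index i mcs).
    apply: (@sorted_leq_nth _ (fun p q : 'I_n.+1 => (p <= q)%N)) => //.
    - by move=> p1 p2 p3; exact: leq_trans.
    - by apply: sub_sorted (cycle_minima_sorted w) => p1 p2; exact: ltnW.
    - by rewrite inE index_mem.
    - by rewrite inE index_mem.
  apply: leq_trans le_im _; rewrite -{1}(cycle_minP mcs) cycle_min_le //.
  by rewrite -iterSr iterS permKV -permX -porbitV mem_porbit.
pose X := G *m A *m invmx G.
have X1 : \det X = 1.
  by rewrite /X !det_mulmx A1 mulr1 det_inv mulrV // -unitmxE.
have [d dE] := closed_root_exists n (\det G)^-1.
have dG : d ^+ n.+1 * \det G = 1 by rewrite dE mulVr -?unitmxE.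
have d0 : d != 0.
  by apply: contraTneq (oner_neq0 k) => d0; rewrite -dG d0 expr0n mul0r eqxx.
exists (d *: G); split; first by rewrite detZ.
have -> : d *: G *m A *m invmx (d *: G) = X.
  rewrite invmxZ ?unitmxZ ?unitfE // -!scalemxAl -scalemxAr scalerA divff //.
  by rewrite scale1r.
apply: in_BwB_upper => // i j ji; have /submxP[c cE] := GA i.
have : row i X = c *m D i.
  by rewrite /X !row_mul cE -!mulmxA mulmxV // mulmx1.
move/rowP/(_ j); rewrite mxE => ->.
by rewrite mul_mx_diag !mxE leqNgt ji mulr0.
Qed.

End Bruhat.

(** * Dominance suffices *)

(** The fibre of [cycle_min] over a minimum is its cycle. *)
Lemma sum_cycle_minima (n : nat) (w : 'S_n.+1) :
  sumn [seq #|porbit w m| | m <- cycle_minima w] = n.+1.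
Proof.
rewrite sumnE big_map big_filter big_enum_cond /= -[RHS](card_ord n.+1) -[RHS]sum1_card.
rewrite [RHS](partition_big (cycle_min w) (fun m => cycle_min w m == m)) /=; last first.
  by move=> j _; rewrite cycle_minP ?cycle_min_mem.
apply: eq_bigr => m /eqP mm; rewrite -[LHS]sum1_card; apply: eq_bigl => j.
apply/idP/eqP => [jm|<-]; last by rewrite cycle_min_porbit porbit_id.
by rewrite -[RHS]mm; apply/eq_cycle_min/eqP; rewrite eq_porbit_mem.
Qed.

Lemma cycle_typeE (n : nat) (w : 'S_n.+1) :
  cycle_type w = sort geq [seq #|porbit w m| | m <- cycle_minima w].
Proof.
apply/perm_sortP; first by move=> a b; exact: leq_total.
- by move=> b a c /= ba cb; exact: leq_trans cb ba.
- by move=> a b /andP[ab ba]; apply/eqP; rewrite eqn_leq; apply/andP.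
rewrite perm_sym; have := perm_map (fun X : {set 'I_n.+1} => #|X|) (perm_cycle_minima w).
by rewrite -map_comp.
Qed.

Lemma sumn_subseq s la : subseq s la -> (sumn s <= sumn la)%N.
Proof.
elim: la s => [|x la IH] [|y s] //=; case: eqP => [->|_] /IH.
  by rewrite leq_add2l.
by move/leq_trans; apply; exact: leq_addl.
Qed.

Lemma sumn_subseq_sorted s la : sorted geq la -> subseq s la ->
  (sumn s <= sumn (take (size s) la))%N.
Proof.
elim: la s => [|x la IH] [|y s] //= xla; case: eqP => [->|_] sla.
  by rewrite leq_add2l IH // (path_sorted xla).
apply: leq_trans (IH _ (path_sorted xla) sla) _ => /=.
have xP : all (geq x) la.
  by apply: order_path_min xla => a b c ba cb; exact: leq_trans cb ba.
have [sl|ls] := ltnP (size s) (size la).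
  rewrite (take_nth 0%N sl) sumn_rcons addnC leq_add2r.
  by apply: (allP xP); rewrite mem_nth.
by rewrite !take_oversize ?leq_addl // ltnW.
Qed.

Lemma dominates_sort la nu : (sumn la <= sumn nu)%N ->
  dominated (sort geq la) nu -> dominates nu la.
Proof.
move=> sum_le D s sla.
have [sn|ns] := leqP (size nu) (size s).
  rewrite [take _ _]take_oversize //; apply: leq_trans sum_le.
  exact: sumn_subseq.
have [s0|s0] := posnP (size s); first by rewrite (size0nil s0).
have := D (size s); rewrite s0 ltnW // => /(_ isT).
rewrite !sum_nth_take; apply: leq_trans.
have geq_tot : total geq by move=> a b; exact: leq_total.
have geq_trans : transitive geq by move=> a b c ab ca; exact: leq_trans ca ab.
rewrite -(perm_sumn (permEl (perm_sort geq s))) -[size s](size_sort geq).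
by apply: sumn_subseq_sorted; [exact: sort_sorted | exact: subseq_sort].
Qed.

Lemma bruhat_of_dominated (k : closedFieldType) (n : nat) (A : 'M[k]_n.+1)
    (js : seq (k * nat)) (w : 'S_n.+1) :
  \det A = 1 -> jordan_form A js -> dominated (cycle_type w) (xi js) ->
  exists g, \det g = 1 /\ in_BwB w (g *m A *m invmx g).
Proof.
move=> A1 Ajs; rewrite cycle_typeE; set la := [seq _ | m <- _] => D.
have sxi : sumn (xi js) = n.+1 by rewrite sumn_xi (size_jordan_form Ajs).
have sla : sumn la = n.+1 := sum_cycle_minima w.
have [zs [zsc zsd zsZ]] := cyclic_chain_of_jordan Ajs.
have la1 : all (leq 1) la.
  by apply/allP => _ /mapP[m _ ->]; rewrite lt0n card_porbit_neq0.
have [||ys [sys tys zys]] := krylov_tower_exists la1 zsc.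
- by rewrite zsd; apply: dominates_sort; rewrite ?sla ?sxi.
- by rewrite zsd sla sxi.
apply: (bruhat_of_tower _ A1 tys); first by rewrite sys size_map.
by apply: zsZ zys; exact: krylov_tower_stable.
Qed.

(** * Rank bounds *)

Section RankBounds.
Variables (k : closedFieldType) (n : nat).
Implicit Types A X Z : 'M[k]_n.+1.

(** The image of [f(A)] is generated by the vectors [z f(A)]; those from [s2]
    vanish, and those from [s1] are killed by [z.2 / f]. *)
Lemma cyclic_chain_rank A s1 s2 f :
  f \is monic -> cyclic_chain A (s1 ++ s2) ->
  (forall Z, stablemx Z A -> {in s1 ++ s2, forall z, (z.1 <= Z)%MS} -> row_full Z) ->
  {in s1, forall z, f %| z.2} -> {in s2, forall z, z.2 %| f} ->
  (\rank (horner_mx A f) + size s1 * (size f).-1 <= sumn (map (@zdeg _ _) s1))%N.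
Proof.
move=> fm [zK _] gen fs1 fs2; pose d := (size f).-1.
have f0 := monic_neq0 fm.
pose l := [seq (z.1 *m horner_mx A f, (zdeg z - d)%N) | z <- s1].
have szdiv z : z \in s1 -> exists g,
    [/\ g \is monic, z.2 = g * f & size g = (zdeg z - d).+1].
  move=> zs; have [|zm _] := zK z; first by rewrite mem_cat zs.
  have /dvdpP[g zE] := fs1 z zs; exists g.
  have gm : g \is monic by rewrite -(monicMr _ fm) -zE.
  split=> //; rewrite /zdeg zE size_mul ?monic_neq0 //.
  have := monic_neq0 gm; move: f0; rewrite -!size_poly_gt0 /d.
  by clear; move: (size f) (size g) => *; lia.
have zk z : z \in s1 -> z.1 *m horner_mx A z.2 = 0.
  by move=> zs; have [|] := zK z; rewrite // mem_cat zs.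
have tl : krylov_tower A l.
  rewrite /l; elim: (s1) szdiv zk {l gen fs1 zK} => //= z s IH szdiv zk.
  split; last by apply: IH => y ys; [apply: szdiv | apply: zk]; rewrite inE ys orbT.
  have [g [gm zE sg]] := szdiv z (mem_head _ _).
  apply: (krylov_top gm sg); last first.
    by rewrite krylov_span_cons -(genmxE (krylov _ _ _)) addsmxSl.
  by rewrite -mulmxA mulmxE -rmorphM mulrC -zE zk ?mem_head // sub0mx.
set K := krylov_span A l.
have rK : (\rank K + size s1 * d <= sumn (map (@zdeg _ _) s1))%N.
  apply: leq_trans (leq_add (krylov_span_rank _ _) (leqnn _)) _.
  have le z : z \in s1 -> (d <= zdeg z)%N.
    move=> zs; have [g [gm zE _]] := szdiv z zs.
    rewrite /zdeg zE size_mul ?monic_neq0 //; have := monic_neq0 gm.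
    rewrite -size_poly_gt0 /d; clear; move: (size f) (size g) => *; lia.
  rewrite big_map /=; elim: (s1) le => [|z s IH] le; first by rewrite big_nil.
  rewrite big_cons /= mulSn addnACA leq_add ?subnK ?le ?mem_head //.
  by apply: IH => y ys; rewrite le // inE ys orbT.
apply: leq_trans rK; rewrite leq_add2r mxrankS //.
(* Z is the preimage of K under f(A); generators lie in it and it is stable. *)
pose Z := kermx (horner_mx A f *m cokermx K).
have ZP v : ((v : 'rV_n.+1) <= Z)%MS = (v *m horner_mx A f <= K)%MS.
  by rewrite /Z (sameP sub_kermxP eqP) mulmxA -submxE.
have sZ : stablemx Z A.
  apply/row_subP => i; rewrite row_mul ZP -mulmxA.
  have -> : A *m horner_mx A f = horner_mx A f *m A by exact/esym/comm_horner_mx.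
  rewrite mulmxA; apply: submx_trans (krylov_tower_stable tl).
  by apply: submxMr; rewrite -ZP row_sub.
have : row_full Z.
  apply: gen => // z; rewrite mem_cat => /orP[zs|zs]; rewrite ZP.
    have [g [gm zE sg]] := szdiv z zs.
    apply: (krylov_base (A := A) gm sg).
      by rewrite -mulmxA mulmxE -rmorphM mulrC -zE zk // sub0mx.
    apply/krylov_subP => j.
    apply: (@mem_krylov_span _ _ A l (z.1 *m horner_mx A f, (zdeg z - d)%N)).
    by apply/mapP; exists z.
  have /dvdpP[g ->] := fs2 z zs.
  have [|_ {}zk] := zK z; first by rewrite mem_cat zs orbT.
  by rewrite mulrC rmorphM -mulmxE mulmxA zk mul0mx sub0mx.
rewrite -sub1mx => /row_subP Z1; apply/row_subP => i.
by have := Z1 i; rewrite ZP -row_mul mul1mx.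
Qed.

(** Reducing modulo [f]: a polynomial in [X] applied to [e] is a combination of
    the first [deg f] images of [e] plus a vector in the image of [f(X)]. *)
Lemma krylov_closure X (es : seq 'rV[k]_n.+1) f : f \is monic ->
  exists Z, [/\ stablemx Z X, {in es, forall e, (e <= Z)%MS} &
    (\rank Z <= \rank (horner_mx X f) + size es * (size f).-1)%N].
Proof.
move=> fm; have sf : size f = (size f).-1.+1.
  by rewrite prednK // size_poly_gt0 monic_neq0.
suff [Z [sZ _ eZ rZ]] : exists Z, [/\ stablemx Z X, (horner_mx X f <= Z)%MS,
    {in es, forall e, (e <= Z)%MS} &
    (\rank Z <= \rank (horner_mx X f) + size es * (size f).-1)%N].
  by exists Z.
elim: es => [|e es [Z [sZ fZ eZ rZ]]].
  exists (horner_mx X f); rewrite addn0; split=> //.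
  exact/comm_mx_stable/comm_horner_mx.
exists (Z + <<krylov X e (size f).-1>>)%MS; split.
- by apply: stable_krylov_monic sZ fm sf _; apply: submx_trans fZ; exact: submxMl.
- exact: submx_trans fZ (addsmxSl _ _).
- move=> v; rewrite inE => /orP[/eqP ->|/eZ vZ]; last first.
    exact: submx_trans vZ (addsmxSl _ _).
  apply: (krylov_base (A := X) fm sf); last by rewrite -(genmxE (krylov _ _ _)) addsmxSr.
  by apply: submx_trans (submx_trans fZ (addsmxSl _ _)); exact: submxMl.
- apply: leq_trans (mxrank_adds_leqif _ _) _; rewrite mulSn addnCA addnC.
  by rewrite leq_add // genmxE rank_leq_row.
Qed.

Lemma in_B_diag (b : 'M[k]_n.+1) i : in_B b -> b i i != 0.
Proof.
case=> b1 /det_trig; rewrite det_tr b1 => /esym/eqP; apply: contraTneq => bi.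
by rewrite (bigD1 i) //= mxE bi mul0r eq_sym oner_eq0.
Qed.

Lemma in_B_upper (b : 'M[k]_n.+1) (i j : 'I_n.+1) : in_B b -> (j < i)%N -> b i j = 0.
Proof. by case=> _ /is_trig_mxP bt ji; have := bt j i ji; rewrite mxE. Qed.

Section Hessenberg.
Variables (w : 'S_n.+1) (X : 'M[k]_n.+1).
Hypothesis wX : in_BwB w X.
Hypothesis w_le : forall i, (w i <= i.+1)%N.

(** In a product [b * dw * b'] the entry at [(j, l)] sums over [s >= j] and
    [q <= l] with [s = w q <= q + 1]; as [j = i + 1], this forces [l >= i], and
    [s = j], [q = i] when [l = i]. *)
Lemma hessenberg_entries (i j : 'I_n.+1) : w i = j -> j = i.+1 :> nat ->
  X j i != 0 /\ forall l : 'I_n.+1, (l < i)%N -> X j l = 0.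
Proof.
case: wX => b [dw [b' [bB [_ dwE] b'B XE]]] wi ji.
have dw0 s q : s != w q -> dw s q = 0.
  by move=> sq; apply/eqP; rewrite -[_ == 0]negbK dwE.
have term (l s q : 'I_n.+1) : (l <= i)%N -> (s != j) || (q != i) || (l != i) ->
    b j s * dw s q * b' q l = 0.
  move=> li neq; have [sj|js] := ltnP s j; first by rewrite (in_B_upper bB) // !mul0r.
  have [sw|/dw0 ->] := eqVneq s (w q); last by rewrite mulr0 mul0r.
  have [lq|ql] := ltnP l q; first by rewrite (in_B_upper b'B) // mulr0.
  have qi : q = i.
    apply: val_inj; apply/eqP; rewrite eqn_leq (leq_trans ql li) /=.
    by rewrite -ltnS -ji (leq_trans js) // sw.
  have li' : l = i by apply: val_inj; apply/eqP; rewrite eqn_leq li -qi.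
  by move: neq; rewrite li' qi sw qi wi !eqxx.
have XjE l : X j l = \sum_q \sum_s b j s * dw s q * b' q l.
  by rewrite XE mxE; apply: eq_bigr => q _; rewrite mxE mulr_suml.
split=> [|l li]; last first.
  have neq : l != i by rewrite -(inj_eq val_inj) /= ltn_eqF.
  rewrite XjE big1 // => q _; rewrite big1 // => s _.
  by rewrite term 1?ltnW // neq !orbT.
rewrite XjE (bigD1 i) //= [X in _ + X]big1 ?addr0; last first.
  by move=> q qi; rewrite big1 // => s _; rewrite term // qi orbT.
rewrite (bigD1 j) //= [X in _ + X]big1 ?addr0; last first.
  by move=> s sj; rewrite term // sj.
by rewrite !mulf_neq0 ?in_B_diag // dwE wi.
Qed.

(** Descending induction on [i]: when [w i = i + 1], row [i + 1] of [X] recovers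
    the basis vector [i] from vectors already known to lie in [Z]. *)
Lemma hessenberg_generate p (Z : 'M[k]_n.+1) : stablemx Z X ->
  (forall i : 'I_n.+1, (p <= i)%N -> w i != i.+1 :> nat ->
     (delta_mx (0 : 'I_1) i <= Z)%MS) ->
  (n.+1 - p <= \rank Z)%N.
Proof.
move=> sZ eZ.
have all_eZ c (i : 'I_n.+1) : (p <= i)%N -> (n.+1 - i <= c)%N ->
    (delta_mx (0 : 'I_1) i <= Z)%MS.
  elim: c i => [|c IH] i pi; first by rewrite leqn0 subn_eq0 leqNgt ltn_ord.
  move=> ic; have [wi|] := eqVneq (w i : nat) i.+1; last exact: eZ.
  have [Xji Xjl] := hessenberg_entries (erefl (w i)) wi.
  have e_wi : (delta_mx (0 : 'I_1) (w i) <= Z)%MS.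
    by apply: IH; rewrite wi ?leqW // subnS -subn1 leq_subLR add1n.
  have rowE' : row (w i) X = X (w i) i *: delta_mx 0 i
      + \sum_(l < n.+1 | (i < l)%N) X (w i) l *: delta_mx 0 l.
    rewrite [LHS]row_sum_delta (bigID (fun l : 'I_n.+1 => (i < l)%N)) /= addrC.
    congr (_ + _); last by apply: eq_bigr => l _; rewrite mxE.
    rewrite (bigD1 i) ?ltnn //= mxE big1 ?addr0 // => l /andP[il li].
    by rewrite mxE Xjl ?scale0r // ltn_neqAle li leqNgt il.
  have -> : delta_mx 0 i = (X (w i) i)^-1 *: (row (w i) X
      - \sum_(l < n.+1 | (i < l)%N) X (w i) l *: delta_mx 0 l) :> 'rV[k]_n.+1.
    by rewrite rowE' addrK scalerA mulVf // scale1r.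
  apply: scalemx_sub; apply: addmx_sub.
    by rewrite rowE; apply: submx_trans (submxMr _ e_wi) sZ.
  rewrite eqmx_opp; apply: summx_sub => l il; apply: scalemx_sub; apply: IH.
    by apply: leq_trans pi _; exact: ltnW.
  by have := ltn_ord l; move: il ic; clear; lia.
have [pn|np] := leqP p n.+1; last by move: (ltnW np); rewrite -subn_eq0 => /eqP ->.
rewrite -(rank_copid_mx k pn); apply: mxrankS; apply/row_subP => i.
have [ip|pi] := ltnP i p.
  rewrite (_ : row i _ = 0) ?sub0mx //; apply/rowP => j.
  by rewrite !mxE ip andbT subrr.
rewrite (_ : row i _ = delta_mx 0 i); first by apply: (all_eZ n.+1); rewrite ?leq_subr.
apply/rowP => j; rewrite !mxE ltnNge pi andbF subr0 eqxx /=.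
by rewrite eq_sym.
Qed.

End Hessenberg.
End RankBounds.

(** * Conjugates with consecutive cycles *)

Section ConsecutiveCycles.
Variables (n : nat) (w : 'S_n.+1).

(** The cycle decomposition of [w] written without parentheses, one cycle for
    each starting point in [r]. *)
Definition cycle_word (r : seq 'I_n.+1) : seq 'I_n.+1 :=
  flatten [seq traject w x #|porbit w x| | x <- r].

Lemma cycle_word_cons x r :
  cycle_word (x :: r) = traject w x #|porbit w x| ++ cycle_word r.
Proof. by []. Qed.

Lemma cycle_word_cat r1 r2 : cycle_word (r1 ++ r2) = cycle_word r1 ++ cycle_word r2.
Proof. by rewrite /cycle_word map_cat flatten_cat. Qed.

Lemma size_cycle_word r :
  size (cycle_word r) = sumn [seq #|porbit w x| | x <- r].
Proof. by elim: r => //= x r IH; rewrite size_cat size_traject IH. Qed.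

Lemma mem_cycle_word y r : (y \in cycle_word r) = (porbit w y \in map (porbit w) r).
Proof.
elim: r => // x r IH.
by rewrite cycle_word_cons mem_cat IH inE -porbit_traject -eq_porbit_mem.
Qed.

Lemma porbit_image y : porbit w (w y) = porbit w y.
Proof. by have := porbit_perm w 1 y; rewrite expg1. Qed.

Lemma cycle_word_uniq r : uniq (map (porbit w) r) -> uniq (cycle_word r).
Proof.
elim: r => // x r IH /= /andP[xr ur]; rewrite cat_uniq uniq_traject_porbit IH //.
rewrite andbT; apply/hasPn => y; rewrite mem_cycle_word -porbit_traject => yr.
by apply: contra xr; rewrite -eq_porbit_mem => /eqP <-.
Qed.

Lemma index_cycle_word r y : uniq (map (porbit w) r) -> y \in cycle_word r ->
  let s := cycle_word r in
  (w y \in r /\ (index (w y) s <= index y s)%N) \/ index (w y) s = (index y s).+1.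
Proof.
elim: r => // x r IH /= /andP[xr ur]; rewrite cycle_word_cons.
set T := traject _ _ _.
have TE z : (z \in T) = (porbit w z == porbit w x).
  by rewrite -porbit_traject eq_porbit_mem.
have [yT _|yT] := boolP (y \in T).
  rewrite !index_cat TE porbit_image -TE yT.
  have yE : nth x T (index y T) = y by exact: nth_index.
  have iT : (index y T < #|porbit w x|)%N.
    by rewrite -[X in (_ < X)%N](size_traject w x) index_mem.
  have wyE : w y = iter (index y T).+1 w x by rewrite iterS -{1}yE nth_traject.
  have [lt|ge] := ltnP (index y T).+1 #|porbit w x|.
    right; rewrite wyE -(nth_traject w lt) index_uniq ?size_traject //.
    exact: uniq_traject_porbit.
  have last : (index y T).+1 = #|porbit w x| by apply/eqP; rewrite eqn_leq iT ge.
  left; rewrite wyE last iter_porbit inE eqxx; split=> //.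
  by rewrite /T; case: #|porbit w x| iT => //= m _; rewrite eqxx.
rewrite mem_cat (negPf yT) /= => yr.
rewrite !index_cat TE porbit_image -TE (negPf yT).
case: (IH ur yr) => [[wr le]|->]; last by right; rewrite addnS.
by left; rewrite inE wr orbT leq_add2l.
Qed.

(** Conjugating by [x |-> index x s], where [s] is the cycle word of [r1 ++ r2],
    renumbers the elements in the order of the word, so the cycles of [r2]
    occupy the last positions.  Only the elements [w^-1 x] with [x] in [r2],
    which end a cycle, can fail there to be moved one step to the right. *)
Lemma consecutive_conjugate r1 r2 :
  uniq (map (porbit w) (r1 ++ r2)) ->
  (forall y, porbit w y \in map (porbit w) (r1 ++ r2)) ->
  exists c : 'S_n.+1, (forall i, ((w ^ c)%g i <= i.+1)%N) /\
    forall i : 'I_n.+1, (n.+1 - sumn [seq #|porbit w x| | x <- r2] <= i)%N ->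
      (w ^ c)%g i != i.+1 :> nat -> exists2 x, x \in r2 & i = c (w^-1%g x).
Proof.
set r := r1 ++ r2 => ur allr; pose s := cycle_word r.
have us : uniq s by exact: cycle_word_uniq.
have smem y : y \in s by rewrite mem_cycle_word.
have size_s : size s = n.+1.
  rewrite -[RHS](card_ord n.+1) -(card_uniqP us); apply: eq_card => y.
  by rewrite smem.
have lt y : (index y s < n.+1)%N.
  by rewrite -[X in (_ < X)%N]size_s index_mem.
have ci : injective (fun y => Ordinal (lt y)).
  by move=> y z [] /(congr1 (nth y s)); rewrite !nth_index.
pose c := perm ci; exists c.
have cE y : c y = index y s :> nat by rewrite permE.
split=> [i|i].
  rewrite -[i](permKV c) permJ !cE.
  by case: (index_cycle_word ur (smem (c^-1%g i))) => [[_ /leqW]|->].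
rewrite -[i](permKV c) permJ; set y := c^-1%g i; rewrite !cE => yi neq.
have sE : s = cycle_word r1 ++ cycle_word r2 := cycle_word_cat r1 r2.
have y1 : y \notin cycle_word r1.
  apply: contraL yi => y1; rewrite -ltnNge -size_cycle_word -[X in (_ < X - _)%N]size_s.
  rewrite sE size_cat addnK.
  by rewrite index_cat y1 index_mem.
have y2 : y \in cycle_word r2 by have := smem y; rewrite sE mem_cat (negPf y1).
have ur2 : uniq (map (porbit w) r2) by move: ur; rewrite map_cat cat_uniq => /and3P[].
exists (w y); last by rewrite permK.
case: (index_cycle_word ur2 y2) => [[]//|E]; case/negP: neq; apply/eqP.
rewrite sE !index_cat (negPf y1).
have /negPf -> : w y \notin cycle_word r1.
  by rewrite mem_cycle_word porbit_image -mem_cycle_word.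
by rewrite E addnS.
Qed.

Lemma cycle_representatives :
  exists r, [/\ [seq #|porbit w x| | x <- r] = cycle_type w, uniq (map (porbit w) r) &
    forall y, porbit w y \in map (porbit w) r].
Proof.
pose L := sort (relpre (fun X : {set 'I_n.+1} => #|X|) geq) (enum (porbits w)).
have [r rE] : exists r, map (porbit w) r = L.
  have : {subset L <= porbits w} by move=> X; rewrite mem_sort mem_enum.
  elim: L => [|X L IH] LP; first by exists [::].
  have /imsetP[x _ ->] := LP X (mem_head _ _).
  have [Y YL|r <-] := IH; first by apply: LP; rewrite inE YL orbT.
  by exists (x :: r).
exists r; split.
- by rewrite (map_comp (fun X : {set _} => #|X|)) rE /cycle_type sort_map.
- by rewrite rE sort_uniq enum_uniq.
- by move=> y; rewrite rE mem_sort mem_enum imset_f.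
Qed.

End ConsecutiveCycles.

(** * Dominance is necessary *)

Lemma cyclic_chain_dvd_take (k : closedFieldType) (n : nat) (A : 'M[k]_n.+1) zs m :
  cyclic_chain A zs -> {in take m zs, forall z, (nth (0, 1) zs m).2 %| z.2}.
Proof.
case=> _ zP z zm; have [ms|sm] := ltnP m (size zs); last first.
  by rewrite nth_default // dvd1p.
move: zP; rewrite -{1}(cat_take_drop m zs) (drop_nth (0, 1) ms) pairwise_cat.
by rewrite allrel_consr => /and3P[/andP[/allP /(_ z zm)]].
Qed.

Lemma cyclic_chain_dvd_drop (k : closedFieldType) (n : nat) (A : 'M[k]_n.+1) zs m :
  cyclic_chain A zs -> {in drop m zs, forall z, z.2 %| (nth (0, 1) zs m).2}.
Proof.
case=> _ zP z; have [ms|sm] := ltnP m (size zs); last by rewrite drop_oversize.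
move: zP; rewrite -{1}(cat_take_drop m zs) (drop_nth (0, 1) ms) pairwise_cat.
move=> /and3P[_ _ /= /andP[/allP zd _]]; rewrite inE => /orP[/eqP -> //|/zd].
by [].
Qed.

(** The [m] longest cycles are put last and compared with [f], the polynomial
    following the first [m] ones; past the end of the chain the default is
    [f = 1], and the bound is the total dimension. *)
Lemma dominated_of_bruhat (k : closedFieldType) (n : nat) (A : 'M[k]_n.+1)
    (js : seq (k * nat)) (w : 'S_n.+1) : jordan_form A js ->
  (forall c : 'S_n.+1, exists2 X, in_BwB (w ^ c)%g X &
     exists2 g, g \in unitmx & X = g *m A *m invmx g) ->
  dominated (cycle_type w) (xi js).
Proof.
move=> Ajs wA m /andP[m0 mnu].
have [zs [zsc zsd zsZ]] := cyclic_chain_of_jordan Ajs.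
have szs : size zs = size (xi js) by rewrite -zsd size_map.
have [r [rE ur allr]] := cycle_representatives w.
have rrE : rev (drop m r) ++ rev (take m r) = rev r by rewrite -rev_cat cat_take_drop.
have [||c [w_le bad]] := @consecutive_conjugate _ w (rev (drop m r)) (rev (take m r)).
- by rewrite rrE map_rev rev_uniq.
- by move=> y; rewrite rrE map_rev mem_rev.
have [X wX [g gu XE]] := wA c.
pose f := (nth (0, 1) zs m).2.
have fm : f \is monic.
  have [mz|zm] := ltnP m (size zs); last by rewrite /f nth_default ?monic1.
  by have [zK _] := zsc; have [] := zK _ (mem_nth (0, 1) mz).
have rank_X : \rank (horner_mx X f) = \rank (horner_mx A f).
  rewrite XE horner_mx_uconj // mxrankMfree ?row_free_unit ?unitmx_inv //.
  by rewrite eqmxMfull ?row_full_unit.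
have chain : (\rank (horner_mx A f) + size (take m zs) * (size f).-1
    <= sumn (map (@zdeg _ _) (take m zs)))%N.
  apply: (cyclic_chain_rank (s2 := drop m zs) fm); rewrite ?cat_take_drop //.
  - exact: cyclic_chain_dvd_take zsc.
  - exact: cyclic_chain_dvd_drop zsc.
have [Z [sZ eZ rZ]] := krylov_closure X
  [seq delta_mx (0 : 'I_1) (c (w^-1%g x)) | x <- rev (take m r)] fm.
have hs := hessenberg_generate wX w_le sZ.
have {hs} := hs (n.+1 - sumn [seq #|porbit w x| | x <- rev (take m r)])%N.
have -> : sumn [seq #|porbit w x| | x <- rev (take m r)] = sumn (take m (cycle_type w)).
  by rewrite map_rev sumn_rev map_take rE.
have sle : (sumn (take m (cycle_type w)) <= n.+1)%N.
  apply: leq_trans (sumn_subseq (take_subseq _ _)) _.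
  by rewrite cycle_typeE (perm_sumn (permEl (perm_sort geq _))) sum_cycle_minima.
rewrite subKn // !sum_nth_take -zsd -map_take => hs.
apply: leq_trans (leq_trans (hs _) _) chain.
  move=> i pi neq; have [|x xr ->] := bad i _ neq.
    by rewrite map_rev sumn_rev map_take rE.
  by apply: eZ; apply/mapP; exists x.
apply: leq_trans rZ _; rewrite rank_X leq_add2l leq_mul2r; apply/orP; right.
rewrite size_map size_rev !size_take_min szs (minn_idPl mnu).
exact: geq_minl.
Qed.

(** * The theorem *)

Theorem theorem4p8 (k : closedFieldType) (n : nat) (hn : (1 <= n)%N)
  (O : {set 'S_n.+1}) (hO : O \in classes [set: 'S_n.+1])
  (C : 'M[k]_n.+1 -> Prop) (hC : SL_conj_class C)
  (nu : seq nat) (hnu : is_nu_star C nu) :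
  (forall w, w \in O -> W_ C w) <-> dominated (lambda O) nu.
Proof.
case: hC => A0 A01 CE; case: hnu => A [js [CA Ajs ->{nu}]].
have [g0 g01 AE] := (CE A).1 CA.
have unit1 (g : 'M[k]_n.+1) : \det g = 1 -> g \in unitmx.
  by move=> g1; rewrite unitmxE g1 unitr1.
have A1 : \det A = 1.
  by rewrite AE !det_mulmx det_inv g01 A01 invr1 !mulr1.
split=> [OC|D w wO].
  have [w0 _ OE] := imsetP hO.
  have w0O : w0 \in O by rewrite OE class_refl.
  rewrite (lambdaE hO w0O); apply: dominated_of_bruhat Ajs _ => c.
  have [|X CX wX] := OC (w0 ^ c)%g; first by rewrite OE memJ_class ?inE.
  exists X => //; have [h h1 ->] := (CE X).1 CX.
  exists (h *m invmx g0).
    by rewrite unitmx_mul unitmx_inv !unit1.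
  rewrite AE -!conjumx ?unitmx_mul ?unitmx_inv ?unit1 //.
  by rewrite -!conjuMumx ?unitmx_mul ?unitmx_inv ?unit1 // mulmxKV ?unit1.
rewrite (lambdaE hO wO) in D.
have [g [g1 wX]] := bruhat_of_dominated A1 Ajs D.
exists (g *m A *m invmx g) => //; apply/CE; exists (g *m g0).
  by rewrite det_mulmx g1 g01 mulr1.
by rewrite AE -!conjumx ?unitmx_mul ?unit1 // conjuMumx ?unit1.
Qed.
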